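(* Let $R$ be an integral domain and $\ast$ a star operation on $R$. If $R$ is $\widetilde{\ast}$-Noetherian and all the $\ast$-maximal ideals of $R$ are $\ast$-stable, then $\ast\text{-}\dim(R)=1=t\text{-}\dim(R)$. In particular: (1) If $R$ is Noetherian and $\ast$-stable, then $\ast\text{-}\dim(R)=1=t\text{-}\dim(R)$. (2) If $R$ is strong Mori and $t$-stable, then $t\text{-}\dim(R)=1$.
   Context: Let $R$ be an integral domain with field of fractions $K$. An ideal of $R$ means a nonzero fractional ideal; it is integral if it is contained in $R$; $\mathcal F(R)$ is the set of ideals of $R$. A star operation on $R$ is a map $\ast:\mathcal F(R)\to\mathcal F(R)$, $I\mapsto I^\ast$, such that for all $0\ne a\in K$ and $I,J\in\mathcal F(R)$: $(aI)^\ast=aI^\ast$ and $R^\ast=R$; $I\subseteq I^\ast$, and $I\subseteq J\Rightarrow I^\ast\subseteq J^\ast$; $I^{\ast\ast}=I^\ast$. A $\ast$-ideal is an ideal with $I=I^\ast$; a $\ast$-prime ideal is a nonzero prime ideal that is a $\ast$-ideal; $\ast\text{-}\mathrm{Max}(R)$, the set of $\ast$-maximal ideals, is the set of maximal elements among proper integral $\ast$-ideals. $\ast\text{-}\dim(R)$ is the supremum of the lengths $n$ of chains $(0)\subsetneq P_1\subsetneq\dots\subsetneq P_n$ with all $P_i$ $\ast$-prime. $I^{\ast_f}:=\bigcup\{J^\ast: J\subseteq I\text{ a finitely generated ideal}\}$ and $I^{\widetilde\ast}:=\bigcap_{M\in\ast_f\text{-}\mathrm{Max}(R)}IR_M$.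 With $(J:I):=\{x\in K:xI\subseteq J\}$ and $I^v:=(R:(R:I))$, one sets $t:=v_f$ and $w:=\widetilde v$, i.e. $I^w=\bigcap_{M\in t\text{-}\mathrm{Max}(R)}IR_M$. $R$ is $\ast$-Noetherian if it satisfies the ascending chain condition on integral $\ast$-ideals; strong Mori means $w$-Noetherian. An ideal $I$ is $\ast$-stable if, with $E:=(I^\ast:I^\ast)$, $(I^\ast(E:I^\ast))^\ast=E$ (fractional ideals of $E$ are fractional ideals of $R$). $R$ is $\ast$-stable if every ideal of $R$ is $\ast$-stable.
   Formalization: R is assumed not to be a field; for a field all the hypotheses hold but the star dimension and t-dimension are 0, so the claim as written fails exactly there. *)

(* Defs.v *)
From HB Require Import structures.
From mathcomp Require Import all_boot all_order all_algebra.
From mathcomp Require Import boolp classical_sets constructive_ereal.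

Set Implicit Arguments.
Unset Strict Implicit.
Unset Printing Implicit Defensive.

Import Order.TTheory GRing.Theory Num.Theory.
Local Open Scope classical_set_scope.
Local Open Scope ring_scope.

Local Notation "x %:F" := (FracField.tofrac x).

(* Ideals are subsets of the field of fractions K = {fraction R}; R itself is
   identified with its image in K. *)
Definition base_ring (R : idomainType) : set {fraction R} :=
  range (@FracField.tofrac R).
Arguments base_ring R : clear implicits.

Section StarOperations.
Variable R : idomainType.
Local Notation K := {fraction R}.
Implicit Types (st : set K -> set K) (I J M P : set K).

Definition submodule I : Prop :=
  [/\ I 0,
      forall x y, I x -> I y -> I (x + y) &
      forall (r : R) x, I x -> I (r%:F * x)].

Definition ideal I : Prop :=
  [/\ submodule I,
      exists2 x, I x & x != 0 &
      exists2 d : R, d != 0 & forall x, I x -> base_ring R (d%:F * x)].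

Definition integral_ideal I : Prop := ideal I /\ I `<=` base_ring R.

Definition fg_ideal J : Prop :=
  ideal J /\ exists n (g : 'I_n -> K),
    J = [set x | exists r : 'I_n -> R, x = \sum_i (r i)%:F * g i].

Definition scale (a : K) I : set K := [set a * x | x in I].

Definition ideal_mul I J : set K :=
  [set x | exists n (a b : 'I_n -> K),
     [/\ forall i, I (a i), forall i, J (b i) & x = \sum_i a i * b i]].

(* colon J I is (J : I), computed in K. *)
Definition colon J I : set K := [set x | forall y, I y -> J (x * y)].

(* A star operation is given by a map on all subsets of K; only its values on
   (nonzero fractional) ideals are constrained, and only these matter. *)
Record star_operation st : Prop := StarOperation {
  star_ideal : forall I, ideal I -> ideal (st I);
  star_scale : forall (a : K) I,
    a != 0 -> ideal I -> st (scale a I) = scale a (st I);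
  star_base : st (base_ring R) = base_ring R;
  star_sub : forall I, ideal I -> I `<=` st I;
  star_mono : forall I J, ideal I -> ideal J -> I `<=` J -> st I `<=` st J;
  star_idem : forall I, ideal I -> st (st I) = st I
}.

Definition starred st I : Prop := ideal I /\ I = st I.

Definition prime_ideal P : Prop :=
  [/\ integral_ideal P, P <> base_ring R &
      forall x y : R, P ((x * y)%:F) -> P x%:F \/ P y%:F].

Definition star_prime st P : Prop := prime_ideal P /\ starred st P.

Definition proper_integral_star_ideal st I : Prop :=
  [/\ integral_ideal I, starred st I & I <> base_ring R].

Definition star_max st M : Prop :=
  proper_integral_star_ideal st M /\
  forall J, proper_integral_star_ideal st J -> M `<=` J -> J = M.

Definition star_chain st (n : nat) : Prop :=
  exists P : nat -> set K, P 0%N = [set 0] /\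
    forall i, (i < n)%N -> star_prime st (P i.+1) /\ P i `<` P i.+1.

(* The supremum is taken in the extended integers, hence is +oo when there are
   chains of every length; the default value 0 of supremum is never used, as
   the chain reduced to (0) has length 0. *)
Definition star_dim st : \bar int :=
  supremum 0%E [set (n%:Z)%:E | n in star_chain st].

Definition star_f st I : set K :=
  \bigcup_(J in [set J | fg_ideal J /\ J `<=` I]) st J.

Definition localization M : set K :=
  [set x | exists r s : R, ~ M s%:F /\ x = r%:F / s%:F].

Definition star_tilde st I : set K :=
  \bigcap_(M in star_max (star_f st)) ideal_mul I (localization M).

Definition acc (C : set (set K)) : Prop :=
  forall I : nat -> set K, (forall n, C (I n)) ->
    (forall n, I n `<=` I n.+1) ->
    exists N, forall n, (N <= n)%N -> I n = I N.

Definition star_noetherian st : Prop :=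
  acc [set I | integral_ideal I /\ starred st I].

Definition star_stable_ideal st I : Prop :=
  let E := colon (st I) (st I) in
  st (ideal_mul (st I) (colon E (st I))) = E.

Definition star_stable st : Prop :=
  forall I, ideal I -> star_stable_ideal st I.

End StarOperations.

Definition v_op (R : idomainType) (I : set {fraction R}) : set {fraction R} :=
  colon (base_ring R) (colon (base_ring R) I).
Definition t_op (R : idomainType) := star_f (@v_op R).
Definition w_op (R : idomainType) := star_tilde (@v_op R).

Arguments v_op R I : clear implicits.
Arguments t_op R I : clear implicits.
Arguments w_op R I : clear implicits.

Definition noetherian (R : idomainType) : Prop := acc (@integral_ideal R).

Definition strong_mori (R : idomainType) : Prop := star_noetherian (w_op R).

(* Main.v *)
(* Since [*~ <= * <= v], the hypothesis makes [R] *-Noetherian and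
   v-Noetherian; hence [*] and [v] are of finite type, t-primes are *-primes,
   and it suffices to show that a *-maximal ideal [M] contains no smaller nonzero
   prime [P].
   Localize at [M] to get a Noetherian local ring [A] with maximal ideal [m]; put
   [E := (m : m)], [N := (E : m)], [J := m N], an ideal of [E]. *-stability says
   that [y J] is contained in [m] only if [y] is in [m]. The powers of [J]
   stabilize modulo [m], because [E / m] has finite length, and Nakayama's lemma
   then forces [1] into [J]: [m] is invertible in [E].
   Finally argue as in Krull's principal ideal theorem. The symbolic powers
   [I_k] of [P] stabilize modulo [m^2], and invertibility of [m] in [E] shows
   that [I_k] meets [m^2] inside [m I_k], so [I_k = I_(k+1)] for some [k] by
   Nakayama; applying Nakayama's lemma once more at [P] yields [P = 0]. *)
Require Import Defs.
From mathcomp Require Import all_boot all_order all_algebra.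
From mathcomp Require Import boolp classical_sets constructive_ereal.
From mathcomp Require Import ring.

Set Implicit Arguments.
Unset Strict Implicit.
Unset Printing Implicit Defensive.

Import Order.TTheory GRing.Theory Num.Theory.
Local Open Scope classical_set_scope.
Local Open Scope ring_scope.

(** * Nakayama's lemma and chain conditions *)

Section Submodules.
Variable K : fieldType.
Implicit Types (A B I J L P S X Y : set K) (gs : seq K).

(** The scalars [B] are a parameter because they will be [R], a localization of [R], or the ring
    [(m : m)]. *)
Definition submod B X : Prop :=
  [/\ X 0, forall x y, X x -> X y -> X (x + y) &
      forall b x, B b -> X x -> X (b * x)].

Definition subring B : Prop := [/\ B 1, B (-1) & submod B B].

Lemma submodN B X x : subring B -> submod B X -> X x -> X (- x).
Proof. by case=> _ B1 _ [_ _ XM] Xx; rewrite -mulN1r; apply: XM. Qed.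

Lemma submodB B X x y : subring B -> submod B X -> X x -> X y -> X (x - y).
Proof.
move=> Br Xm Xx Xy; case: (Xm) => _ XD _.
by apply: XD => //; apply: submodN Br Xm Xy.
Qed.

(* With [J] a set of scalars rather than a ring, [span J gs] is the product of
   the ideal [J] by the module generated by [gs]. *)
Fixpoint span J gs : set K :=
  if gs is g :: gs' then
    [set x | exists b y, [/\ J b, span J gs' y & x = b * g + y]]
  else [set 0].

Lemma span_submod B J gs : submod B J -> submod B (span J gs).
Proof.
case=> J0 JD JM; elim: gs => [|g gs [S0 SD SM]] /=.
  by split=> // [x y -> ->|b x _ ->]; rewrite ?addr0 ?mulr0.
split=> [|_ _ [b [x [Jb Sx ->]]] [c [y [Jc Sy ->]]]|a _ Ba [b [x [Jb Sx ->]]]].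
- by exists 0, 0; rewrite mul0r addr0.
- by exists (b + c), (x + y); split; [apply: JD|apply: SD|ring].
- by exists (a * b), (a * x); split; [apply: JM|apply: SM|ring].
Qed.

Lemma span_mono I J gs : I `<=` J -> span I gs `<=` span J gs.
Proof.
move=> IJ; elim: gs => [//|g gs IH] _ [b [x [Ib Sx ->]]].
by exists b, x; split=> //; [apply: IJ|apply: IH].
Qed.

Lemma span_min I B X gs :
  submod B X -> (forall b g, I b -> g \in gs -> X (b * g)) -> span I gs `<=` X.
Proof.
case=> X0 XD _; elim: gs => [|g gs IH] IX; first by move=> _ ->.
move=> _ [b [x [Ib Sx ->]]]; apply: (XD); first by apply: (IX); rewrite ?mem_head.
by apply: IH Sx => c h Ic hg; apply: (IX); rewrite // in_cons hg orbT.
Qed.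

Lemma span_gen J gs b g : J 0 -> J b -> g \in gs -> span J gs (b * g).
Proof.
move=> J0 Jb.
have S0 hs : span J hs 0.
  by elim: hs => //= h hs S0; exists 0, 0; rewrite mul0r addr0.
elim: gs => [//|h gs IH]; rewrite in_cons => /orP[/eqP->|/IH Sg].
  by exists b, 0; rewrite addr0.
by exists 0, (b * g); rewrite mul0r add0r.
Qed.

Lemma span_scale J gs z : span J (map ( *%R z) gs) = [set z * x | x in span J gs].
Proof.
elim: gs => [|g gs IH] /=.
  by apply/seteqP; split=> [_ ->|_ [_ -> <-]]; [exists 0|]; rewrite ?mulr0.
apply/seteqP; split=> [_ [b [y [Jb + ->]]]|_ [_ [b [y [Jb Sy ->]]] <-]].
  rewrite IH => -[x Sx <-]; exists (b * g + x); last by ring.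
  by exists b, x.
by exists b, (z * y); split; [|rewrite IH; exists y|ring].
Qed.

(* The determinant trick in the form of Nakayama's lemma: take [S = 1 + J]. *)
Lemma nakayama B J S L gs :
    subring B -> submod B J -> J `<=` B -> S `<=` B -> S 1 ->
    (forall s t, S s -> S t -> S (s * t)) ->
    (forall s j, S s -> J j -> S (s + j)) -> submod B L ->
    (forall g, g \in gs -> exists2 s, S s &
      exists l x, [/\ L l, span J gs x & s * g = l + x]) ->
  exists2 s, S s & forall g, g \in gs -> L (s * g).
Proof.
move=> Br Jm JB SB S1 SM SD Lm; have [L0 LD LM] := Lm.
have [J0 JD JM] := Jm.
elim: gs => [|g gs IH] H; first by exists 1.
have [Sp0 SpD SpM] := span_submod gs Jm.
have [s Ss [l [_ [Ll [j [x [Jj Sx ->]]] sgE]]]] := H g (mem_head _ _).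
(* The term [j * g] moves to the left: [(s - j) * g = l + x], and [s - j] is still in [S]. *)
pose u := s - j.
have Su : S u by apply: SD => //; apply: submodN Br Jm Jj.
have ugE : u * g = l + x.
  by rewrite mulrBl sgE addrA addrAC [l + _]addrC addrK.
(* Each relation for [h] in [gs] is multiplied by [u], so that [u * g] can be replaced with [l + x];
   this eliminates [g]. *)
have [h hgs|t St tP] := IH.
  have [|s' Ss' [l' [_ [Ll' [j' [x' [Jj' Sx' ->]]] s'hE]]]] := H h.
    by rewrite in_cons hgs orbT.
  exists (u * s'); first exact: SM.
  exists (u * l' + j' * l), (u * x' + j' * x); split.
  - by apply: (LD); apply: LM => //; [apply: SB|apply: JB].
  - by apply: SpD; apply: SpM => //; [apply: SB|apply: JB].
  - rewrite -mulrA s'hE; transitivity (u * l' + u * x' + j' * (u * g)); last first.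
      by rewrite ugE; ring.
    by ring.
exists (t * u); first exact: SM.
move=> h; rewrite in_cons => /orP[/eqP->|hgs].
  rewrite -mulrA ugE mulrDr; apply: (LD); first by apply: LM => //; apply: SB.
  have : span J gs `<=` [set y | L (t * y)].
    apply: (@span_min _ B); first split=> /= [|y z Ly Lz|b y Bb Ly].
    - by rewrite mulr0.
    - by rewrite mulrDr; apply: LD.
    - by rewrite mulrCA; apply: LM.
    - by move=> b h' Jb h'gs /=; rewrite mulrCA; apply: (LM); [apply: JB|apply: tP].
  by apply.
by rewrite mulrAC mulrC; apply: (LM); [apply: SB|apply: tP].
Qed.

(* [L + <gs>] modulo [L] is a finite dimensional vector space over the residue
   field of the local ring [A], so descending chains in it stabilize. *)
Lemma dcc_over_residue_field A m L gs (X : nat -> set K) :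
    subring A -> (forall a, A a -> ~ m a -> A a^-1 /\ a != 0) ->
    submod A L -> (forall a g, m a -> g \in gs -> L (a * g)) ->
    (forall k, submod A (X k)) -> (forall k, X k.+1 `<=` X k) ->
    (forall k, L `<=` X k) ->
    (forall k x, X k x -> exists l y, [/\ L l, span A gs y & x = l + y]) ->
  exists k0, forall k, (k0 <= k)%N -> X k `<=` X k.+1.
Proof.
move=> Ar Am Lm; have [L0 LD LM] := Lm; have [A1 AN1 Asub] := Ar.
have [A0 AD AM] := Asub.
elim: gs X => [|g gs IH] X mL Xm Xdec LX XL.
  exists 0%N => k _ x /XL [l [_ [Ll -> ->]]].
  by rewrite addr0; apply: LX.
have [Sp0 SpD SpM] := span_submod gs Asub.
(* [V] is [L + <gs>] without the generator [g]; the induction hypothesis handles the traces of the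
   [X k] on it. *)
pose V := [set x | exists l y, [/\ L l, span A gs y & x = l + y]].
have Vm : submod A V.
  split=> [|_ _ [l [y [Ll Sy ->]]] [l' [y' [Ll' Sy' ->]]]|a _ Aa [l [y [Ll Sy ->]]]].
  - by exists 0, 0; rewrite addr0.
  - by exists (l + l'), (y + y'); split; [apply: LD|apply: SpD|ring].
  - by exists (a * l), (a * y); split; [apply: LM|apply: SpM|ring].
have [V0 VD VM] := Vm.
have LV : L `<=` V by move=> l Ll; exists l, 0; rewrite addr0.
have [|||||k1 k1P] := IH (fun k => X k `&` V).
- by move=> a h ma hgs; apply: mL => //; rewrite in_cons hgs orbT.
- move=> k; have [X0 XD XM] := Xm k.
  by split=> [|x y [? ?] [? ?]|b x ? [? ?]]; split=> //; auto.
- by move=> k x [/Xdec Xx Vx].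
- by move=> k x Lx; split; [apply: LX|apply: LV].
- by move=> k x [].
have XV k x : X k x -> exists a y, [/\ A a, V y & x = a * g + y].
  case/XL=> l [_ [Ll [a [y [Aa Sy ->]]] ->]]; exists a, (l + y); split=> //.
    by exists l, y.
  by ring.
(* [C k] says that some element of [X k] has coefficient 1 at [g]. If this always holds, subtracting
   a multiple of such an element brings [x] into [V]. If it fails at [k2], then from there on no
   coefficient of [g] is a unit; all lie in [m], so [a * g] is in [L] and [X k] is inside [V]. *)
pose C k := exists2 y, V y & X k (g + y).
case: (pselect (forall k, C k)) => [allC|/existsNP[k2 nC]].
  exists k1 => k k1k x Xx.
  have [a [y [Aa Vy xE]]] := XV _ _ Xx.
  have [z Vz Xz] := allC k.+1; have [_ XD XM] := Xm k.+1.
  have [X1 Vw] : (X k.+1 `&` V) (x - a * (g + z)).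
    apply: (k1P k k1k); split.
      apply: (submodB Ar (Xm k)) => //; apply: Xdec; exact: XM.
    rewrite xE (_ : _ - _ = y - a * z); last by ring.
    by apply: (submodB Ar Vm) => //; apply: VM.
  by rewrite -[x](subrK (a * (g + z))); apply: XD => //; apply: XM.
exists (maxn k1 k2) => k; rewrite geq_max => /andP[k1k k2k] x Xx.
have Xle i j : (i <= j)%N -> X j `<=` X i.
  elim: j => [|j IHj]; first by rewrite leqn0 => /eqP->.
  rewrite leq_eqVlt => /orP[/eqP->//|]; rewrite ltnS => /IHj ij.
  by apply: subset_trans ij; apply: Xdec.
have [a [y [Aa Vy xE]]] := XV _ _ Xx.
have Vx : V x.
  case: (pselect (m a)) => [ma|nma].
    rewrite xE; apply: VD => //; apply: (LV); apply: mL => //; exact: mem_head.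
  case: nC; have [Aa' a0] := Am _ Aa nma.
  exists (a^-1 * y); first exact: VM.
  rewrite (_ : g + _ = a^-1 * x); last by rewrite xE mulrDr mulKf.
  by apply: (Xle _ _ k2k); have [_ _ XM] := Xm k; apply: XM.
by case: (k1P k k1k x (conj Xx Vx)).
Qed.

(** The same finite sums of products as in [ideal_mul], over any field and in a form suited to
    induction. *)
Inductive prods I J : set K :=
| prods0 : prods I J 0
| prodsMD a b x : I a -> J b -> prods I J x -> prods I J (a * b + x).

Lemma prodsM I J a b : I a -> J b -> prods I J (a * b).
Proof. by move=> Ia Jb; rewrite -[_ * _]addr0; apply: prodsMD => //; left. Qed.

Lemma prodsD I J x y : prods I J x -> prods I J y -> prods I J (x + y).
Proof.
move=> + IJy; elim=> [|a b {}x Ia Jb _ IH]; first by rewrite add0r.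
by rewrite -addrA; apply: prodsMD.
Qed.

Lemma prods_min I J X :
  X 0 -> (forall x y, X x -> X y -> X (x + y)) ->
  (forall a b, I a -> J b -> X (a * b)) -> prods I J `<=` X.
Proof.
move=> X0 XD XM x; elim=> // a b {}x Ia Jb _ Xx; apply: XD => //; exact: XM.
Qed.

Lemma prods_submod B I J : submod B I -> submod B (prods I J).
Proof.
case=> _ _ IM; split=> [|x y|b x Bb]; [exact: prods0|exact: prodsD|].
elim=> [|a c {}x Ia Jc _ IH]; first by rewrite mulr0; apply: prods0.
by rewrite mulrDr mulrA; apply: prodsMD => //; apply: IM.
Qed.

(** The coefficients from [B] are absorbed by [I]. This brings products to the form that [nakayama]
    expects. *)
Lemma prods_span B I J gs : subring B -> submod B I ->
  J = span B gs -> prods I J `<=` span I gs.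
Proof.
move=> Br Im ->; have [S0 SD SM] := span_submod gs Im; have [I0 _ IM] := Im.
have [_ _ [B0 _ _]] := Br.
apply: prods_min => // a b Ia Sb.
have : span B gs `<=` [set y | span I gs (a * y)].
  apply: (@span_min _ B); first split=> /= [|y z Ly Lz|c y Bc Ly].
  - by rewrite mulr0.
  - by rewrite mulrDr; apply: SD.
  - by rewrite mulrCA; apply: SM.
  - move=> c g Bc gg /=; rewrite mulrCA mulrA; apply: span_gen => //; exact: IM.
by apply.
Qed.

(** * Local rings with a stable maximal ideal *)

(* [N] below is [((m : m) : m)]; hypothesis [mNstable] is what remains, after
   localization, of the star closure of [m N] being [(m : m)]. *)
Lemma stable_local_invertible A m :
    subring A -> submod A m -> m `<=` A ->
    (forall a, A a -> ~ m a -> A a^-1 /\ a != 0) ->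
    (forall X, submod A X -> X `<=` A -> exists gs, X = span A gs) ->
    (exists2 z, m z & z != 0) ->
    let N := [set x | forall a b, m a -> m b -> m (x * a * b)] in
    (forall y, (forall a n, m a -> N n -> m (y * (a * n))) -> m y) ->
  prods m N 1.
Proof.
move=> Ar mm mA Am noeth [z mz z0] N mNstable.
have [A1 _ Asub] := Ar; have [m0 mD mM] := mm.
pose E := [set x | forall a, m a -> m (x * a)].
have E1 : E 1 by move=> a; rewrite mul1r.
have AE : A `<=` E by move=> a Aa b mb; apply: mM.
have Em : submod E E.
  split=> [a _|x y Ex Ey a ma|x y Ex Ey a ma]; first by rewrite mul0r.
    by rewrite mulrDl; apply: (mD); [apply: Ex|apply: Ey].
  by rewrite -mulrA; apply: (Ex); apply: Ey.
have Er : subring E.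
  by split=> // a ma; rewrite mulN1r; apply: submodN Ar mm ma.
have [E0 ED EM] := Em.
have EmA X : submod E X -> submod A X.
  by case=> X0 XD XM; split=> // a x /AE; apply: XM.
have mE : submod E m by split=> // x a Ex /Ex.
pose J := prods m N.
have Jm : submod E J by apply: prods_submod.
have [J0 JD JM] := Jm.
have JE : J `<=` E.
  by apply: prods_min => // a n ma Nn b mb; rewrite [a * n]mulrC; apply: Nn.
have mJ : m `<=` J.
  move=> a ma; rewrite -[a]mulr1; apply: prodsM => // b c mb mc.
  by rewrite mul1r; apply/mM/mc/mA.
(* Multiplication by [z] embeds [E] into [m], so every [A]-submodule of [E] is isomorphic to an
   ideal of [A]. *)
have fgE X : submod A X -> X `<=` E -> exists gs, X = span A gs.
  move=> [X0 XD XM] XE; pose zX := [set z * x | x in X].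
  have [|_ [x /XE Ex <-]|gs gsE] := noeth zX.
  - split=> [|_ _ [x Xx <-] [y Xy <-]|a _ Aa [x Xx <-]].
    + by exists 0; rewrite ?mulr0.
    + by exists (x + y); [apply: XD|rewrite mulrDr].
    + by exists (a * x); [apply: XM|rewrite mulrCA].
  - by apply: mA; rewrite mulrC; apply: Ex.
  exists (map ( *%R z^-1) gs); rewrite span_scale -gsE.
  apply/seteqP; split=> [x Xx|_ [_ [x Xx <-] <-]]; last by rewrite mulKf.
  by exists (z * x); [exists x|rewrite mulKf].
(* The powers of [J], with [J^0 = E]. *)
pose Jn k := iter k (prods J) E.
have Jnm k : submod E (Jn k) by case: k => [|k] //; apply: prods_submod.
have Jndec k : Jn k.+1 `<=` Jn k.
  by have [_ _ JkM] := Jnm k; apply: prods_min => [||a b /JE]; case: (Jnm k); auto.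
have JnE k : Jn k `<=` E by elim: k => //= k IH; apply: subset_trans IH; apply: Jndec.
have [gsE EE] := fgE E (EmA _ Em) (@subset_refl _ E).
(* The chain [m + J^k] stabilizes, since [E] is finitely generated over [A] and [m E] lies in
   [m]. *)
pose V k := [set x | exists a b, [/\ m a, Jn k b & x = a + b]].
have [|k|k|k|k x|k0 k0P] := @dcc_over_residue_field A m m gsE V Ar Am mm.
- move=> a g ma ggs; have Eg : E g.
    by rewrite -[g]mul1r EE; apply: span_gen; case: Asub.
  by rewrite mulrC; apply: Eg.
- have [_ JkD JkM] := Jnm k; have [Jk0 _ _] := Jnm k.
  split=> [|_ _ [a [b [ma Jb ->]]] [c [d [mc Jd ->]]]|r _ Ar' [a [b [ma Jb ->]]]].
  + by exists 0, 0; rewrite addr0.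
  + by exists (a + c), (b + d); split; [apply: mD|apply: JkD|ring].
  + by exists (r * a), (r * b); split; [apply: mM|apply: JkM => //; apply: AE|ring].
- by move=> _ [a [b [ma /Jndec Jb ->]]]; exists a, b.
- by move=> a ma; exists a, 0; rewrite addr0; split=> //; case: (Jnm k).
- by case=> a [b [ma /JnE + ->]]; rewrite EE => Eb; exists a, b.
pose k := k0.
have stab : Jn k `<=` V k.+1.
  move=> x Jx; apply: k0P => //.
  by exists 0, x; rewrite add0r.
have [gs gsE'] := fgE (Jn k) (EmA _ (Jnm k)) (@JnE k).
have gsEE : Jn k = span E gs.
  apply/seteqP; split; first by rewrite gsE'; apply: span_mono.
  apply: (@span_min _ E) => // b g Eb ggs; have [_ _ JkM] := Jnm k; apply: (JkM) => //.
  by rewrite gsE' -[g]mul1r; apply: span_gen; case: Asub.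
(* [S] is [1 + J]. Since [J^k] lies in [m + J J^k], Nakayama's lemma over [E] provides [s] in [S]
   with [s J^k] inside [m]. *)
pose S := [set x | J (1 - x)].
have [||||||s Ss sP] := @nakayama E J S m gs Er Jm JE.
- by move=> x /JE Ex; rewrite -[x](subKr 1); apply: submodB Er Em E1 Ex.
- by rewrite /S /= subrr.
- move=> s t; rewrite /S /= => Js Jt.
  rewrite (_ : 1 - s * t = (1 - s) + ((1 - t) - (1 - s) * (1 - t))); last by ring.
  by apply: (JD) => //; apply: submodB Er Jm _ _ => //; apply: (JM) => //; apply: JE.
- move=> s j Js Jj; rewrite /S /= (_ : _ - _ = (1 - s) - j); last by ring.
  exact: submodB Er Jm _ _.
- exact: mE.
- move=> g ggs; exists 1; first by rewrite /S /= subrr.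
  have /stab [a [b [ma Jb ->]]] : Jn k g.
    by rewrite gsE' -[g]mul1r; apply: span_gen; case: Asub.
  by exists a, b; rewrite mul1r; split=> //; apply: (prods_span Er Jm gsEE).
have sJ x : Jn k x -> m (s * x).
  rewrite gsEE; have : span E gs `<=` [set y | m (s * y)].
    apply: (@span_min _ E) => [|b g Eb ggs /=].
      split=> /= [|x' y mx my|b y Eb my]; rewrite ?mulr0 //.
        by rewrite mulrDr; apply: mD.
      by rewrite mulrCA; apply: Eb.
    by have := Eb _ (sP _ ggs); rewrite mulrCA.
  by apply.
(* Stability removes the factors [J] one at a time, down to [J^0 = E], which contains 1. For
   [y = s], both [s] and [1 - s] are then in [J]. *)
have descent j y : (forall x, Jn j x -> m (y * x)) -> m y.
  elim: j y => [|j IH] y H; first by rewrite -[y]mulr1; apply: H.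
  apply: IH => x Jx; apply: mNstable => a n ma Nn.
  rewrite -mulrA [x * _]mulrC; apply: H.
  by apply: prodsM => //; apply: prodsM.
have /mJ Js := descent _ _ sJ.
by rewrite -[1](subrK s); apply: JD.
Qed.

(** The maximal ideal [m], invertible over [(m : m)], plays the role of the principal ideal in
    Krull's theorem. If some [t] in [m] is outside [P], it may serve as a denominator in symbolic
    powers of [P]; the contradiction is [v * p ^+ k = 0] with [v] outside [P] and [p] nonzero. *)
Lemma stable_local_dim1 A m P :
    subring A -> submod A m -> m `<=` A -> ~ m 1 ->
    (forall a, A a -> ~ m a -> A a^-1 /\ a != 0) ->
    (forall X, submod A X -> X `<=` A -> exists gs, X = span A gs) ->
    let N := [set x | forall a b, m a -> m b -> m (x * a * b)] in
    (forall y, (forall a n, m a -> N n -> m (y * (a * n))) -> m y) ->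
    submod A P -> P `<=` m ->
    (forall a b, A a -> A b -> P (a * b) -> P a \/ P b) ->
  (exists2 p, P p & p != 0) -> m `<=` P.
Proof.
move=> Ar mm mA m1 Am noeth N mNstable Pm Pm' Ppr [p Pp p0] t mt.
apply: contrapT => Pt.
have inv : prods m N 1.
  by apply: stable_local_invertible Ar mm mA Am noeth _ mNstable; exists p; auto.
have [A1 AN1 Asub] := Ar; have [A0 AD AM] := Asub.
have [m0 mD mM] := mm; have [P0 PD PM] := Pm.
have At := mA _ mt.
pose Pn k := iter k (prods P) A.
have Pnm k : submod A (Pn k) by case: k => [|k] //; apply: prods_submod.
have PA : P `<=` A by move=> x /Pm'/mA.
have Pndec k : Pn k.+1 `<=` Pn k.
  by have [? ? PkM] := Pnm k; apply: prods_min => // a b /PA; apply: PkM.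
have PnA k : Pn k `<=` A by elim: k => //= k IH; apply: subset_trans IH; apply: Pndec.
pose T := [set s | A s /\ ~ P s].
have T1 : T 1 by split=> // /Pm'.
have TM s u : T s -> T u -> T (s * u).
  by move=> [As Ps] [Au Pu]; split; [apply: AM|case/(Ppr _ _ As Au)].
have TD s j : T s -> P j -> T (s + j).
  move=> [As Ps] Pj; split; first by apply: AD => //; apply: PA.
  by move=> Psj; apply: Ps; rewrite -[s](addrK j); apply: submodB Ar Pm _ _.
(* [I k] is the [k]-th symbolic power of [P]. *)
pose I k := [set x | A x /\ exists2 s, T s & Pn k (s * x)].
have Im k : submod A (I k).
  have [Pk0 PkD PkM] := Pnm k.
  split=> [|x y [Ax [s Ts Psx]] [Ay [u Tu Puy]]|a x Aa [Ax [s Ts Psx]]].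
  - by split=> //; exists 1; rewrite ?mulr0.
  - split; first exact: AD.
    exists (s * u); first exact: TM.
    rewrite (_ : _ * _ = u * (s * x) + s * (u * y)); last by ring.
    apply: PkD; apply: PkM => //.
    + by case: Tu.
    + by case: Ts.
  - split; first exact: AM.
    by exists s => //; rewrite mulrCA; apply: PkM.
have IA k : I k `<=` A by move=> x [].
have Idec k : I k.+1 `<=` I k.
  by move=> x [Ax [s Ts /Pndec Psx]]; split=> //; exists s.
have I_P k : (0 < k)%N -> I k `<=` P.
  case: k => // k _ x [Ax [s [As Ps] Psx]].
  have /(Ppr _ _ As Ax)[/Ps//|//] : P (s * x).
  suff: Pn k.+1 `<=` P by apply.
  by apply: prods_min => // a b Pa /PnA Ab; rewrite mulrC; apply: PM.
(* The shift to [k.+1] keeps [X k] inside [m]: [I 0] is all of [A], whereas [I k.+1] lies in [P]. *)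
pose X k := [set x | exists a b, [/\ prods m m a, I k.+1 b & x = a + b]].
have mmm : submod A (prods m m) by apply: prods_submod.
have [mm0 mmD mmM] := mmm.
have [gm gmE] := noeth m mm mA.
have [|k|k|k|k x|k0 k0P] := @dcc_over_residue_field A m (prods m m) gm X Ar Am mmm.
- move=> a g ma ggm; apply: prodsM => //.
  by rewrite -[g]mul1r gmE; apply: span_gen.
- have [Ik0 IkD IkM] := Im k.+1.
  split=> [|_ _ [a [b [ma Jb ->]]] [c [d [mc Jd ->]]]|r _ Ar' [a [b [ma Jb ->]]]].
  + by exists 0, 0; rewrite addr0.
  + by exists (a + c), (b + d); split; [apply: mmD|apply: IkD|ring].
  + by exists (r * a), (r * b); split; [apply: mmM|apply: IkM|ring].
- by move=> _ [a [b [ma /Idec Ib ->]]]; exists a, b.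
- by move=> a ma; exists a, 0; rewrite addr0; split=> //; case: (Im k.+1).
- by case=> a [b [ma /(I_P k.+1 isT)/Pm' + ->]]; rewrite {1}gmE => mb; exists a, b.
pose k := k0.+1.
have Pmx x : prods m m x -> m x.
  by apply: prods_min => // a b /mA; apply: mM.
(* Write 1 as a sum of products [a * n] with [a] in [m] and [n] in [N]; then [c] is the sum of the
   [a * (c * n)]. Each [c * n] is in [I k], because [n * t * t] is in [A] and [s * (t * t)] is
   outside [P]. *)
have mmI c : prods m m c -> I k c -> prods m (I k) c.
  move=> mmc [Ac [s [As Ps] Psc]].
  have Ic n : N n -> I k (c * n).
    move=> Nn; have mcn : m (c * n).
      have : prods m m `<=` [set c | m (c * n)].
        apply: prods_min => /= [|x y|a b ma mb]; first by rewrite mul0r.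
          by rewrite mulrDl; apply: mD.
        by rewrite mulrC mulrA; apply: Nn.
      by apply.
    split; first exact: mA.
    exists (s * (t * t)); first by do 2![apply: (TM) => //].
    rewrite (_ : _ * _ = (n * t * t) * (s * c)); last by ring.
    by have [_ _ PkM] := Pnm k; apply: (PkM) => //; apply: mA; apply: Nn.
  have : prods m N `<=` [set x | prods m (I k) (c * x)].
    apply: prods_min => /= [|x y|a n ma Nn]; first by rewrite mulr0; left.
      by rewrite mulrDr; apply: prodsD.
    by rewrite mulrCA; apply: prodsM => //; apply: Ic.
  by move=> /(_ _ inv) /=; rewrite mulr1.
have [gI gIE] := noeth (I k) (Im k) (@IA k).
(* The units of [A]. Nakayama's lemma applies because [I k] lies in [I k.+1 + m I k]. *)
pose U := [set s | A s /\ ~ m s].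
have [|||s j [As ms] mj||x Ix|s [As ms] sP] := @nakayama A m U (I k.+1) gI Ar mm mA.
- by move=> s [].
- by [].
- move=> s u [As ms] [Au mu]; split; first exact: AM.
  have [As' s0] := Am _ As ms.
  by move=> /(mM _ _ As'); rewrite mulKf.
- split; first by apply: AD => //; apply: mA.
  by move=> msj; apply: ms; rewrite -[s](addrK j); apply: submodB Ar mm _ _.
- exact: Im.
- exists 1 => //; rewrite mul1r.
  have Ikx : I k x by rewrite gIE -[x]mul1r; apply: span_gen.
  have [|a [b [mma Ib xE]]] := k0P k0 (leqnn _) x.
    by exists 0, x; rewrite add0r; split.
  have Ia : I k a.
    rewrite -[a](addrK b) -xE; apply: submodB Ar (Im k) _ _ => //; exact: Idec.
  exists b, a; split=> //; last by rewrite addrC.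
  by apply: (prods_span Ar mm gIE); apply: mmI.
have IkS : I k `<=` I k.+1.
  rewrite gIE; apply: (@span_min _ A) => // b g Ab ggI.
  have [_ _ IkM] := Im k.+1; apply: IkM => //.
  have [Asg [u Tu Pusg]] := sP _ ggI.
  have Ikg : I k g by rewrite gIE -[g]mul1r; apply: span_gen.
  split; first exact: IA Ikg.
  exists (u * s); last by rewrite -mulrA.
  by apply: TM => //; split=> // /Pm'.
(* Each generator of [P^k] is in [I k.+1], so a multiple of it by some [u] outside [P] lies in
   [P P^k]. Nakayama's lemma with [L = 0] gives a single [v] outside [P] that kills [P^k]. *)
have [gP gPE] := noeth (Pn k) (Pnm k) (@PnA k).
have [||x xgP|v [Av Pv] vP0] := @nakayama A P T [set 0] gP Ar Pm PA _ T1 TM TD.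
- by move=> u [].
- by split=> [//|x y -> ->|b x _ ->]; rewrite ?addr0 ?mulr0.
- have Pkx : Pn k x by rewrite gPE -[x]mul1r; apply: span_gen.
  have /IkS [_ [u Tu Pux]] : I k x.
    by split; [exact: PnA Pkx|exists 1; rewrite ?mul1r].
  exists u => //; exists 0, (u * x); rewrite add0r; split=> //.
  exact: (prods_span Ar Pm gPE).
have Pk0 : Pn k `<=` [set x | v * x = 0].
  rewrite gPE; apply: (@span_min _ A) => [|b g Ab ggP /=].
    split=> /= [|x y sx sy|b x _ sx]; first by rewrite mulr0.
      by rewrite mulrDr sx sy addr0.
    by rewrite mulrCA sx mulr0.
  by rewrite mulrCA vP0 // mulr0.
have Ppk j : Pn j (p ^+ j).
  by elim: j => [|j IH]; rewrite ?expr0 // exprS; apply: prodsM.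
have /eqP := Pk0 _ (Ppk k); rewrite mulf_eq0 expf_eq0 (negPf p0) andbF orbF.
by move=> /eqP v0; apply: Pv; rewrite v0.
Qed.

End Submodules.

(** * Fractional ideals *)

Local Notation "x %:F" := (FracField.tofrac x).

Section FractionalIdeals.
Variable R : idomainType.
Local Notation K := {fraction R}.
Local Notation B := (base_ring R).
Implicit Types (I J F P M : set K) (gs : seq K).

Lemma base_tofrac (r : R) : B r%:F.
Proof. by exists r. Qed.
Hint Resolve base_tofrac : core.

Lemma base1 : B 1.
Proof. by rewrite -(tofrac1 R). Qed.
Hint Resolve base1 : core.

Lemma submoduleE I : submodule I <-> submod B I.
Proof.
split=> -[I0 ID IM]; split=> //; first by move=> _ x [r _ <-]; apply: IM.
by move=> r x; apply: IM.
Qed.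

Lemma base_submod : submod B B.
Proof.
split; first by exists 0; rewrite ?tofrac0.
- by move=> _ _ [r _ <-] [s _ <-]; exists (r + s); rewrite ?tofracD.
- by move=> _ _ [r _ <-] [s _ <-]; exists (r * s); rewrite ?tofracM.
Qed.

Lemma base_subring : subring B.
Proof.
split; [exact: base1| |exact: base_submod].
by exists (-1); rewrite ?tofracN ?tofrac1.
Qed.

Lemma denominator (x : K) : exists2 d : R, d != 0 & B (d%:F * x).
Proof.
(* A fraction is the class of a ratio [z], whose components are the witnesses; the equality is
   checked on representatives. *)
elim/quotW: x => z; exists (frac z).2; first exact: denom_ratioP.
exists (frac z).1 => //; apply/esym.
unlock FracField.tofrac; rewrite -[LHS]FracField.pi_mul.
apply/eqmodP; rewrite /= FracField.equivfE /FracField.mulf.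
by rewrite !numden_Ratio ?mulf_neq0 ?oner_neq0 ?denom_ratioP // !mul1r mulr1 mulrC.
Qed.

Lemma ideal_submod I : ideal I -> submod B I.
Proof. by case=> /submoduleE. Qed.

Lemma ideal_base : ideal B.
Proof.
split; first by apply/submoduleE; exact: base_submod.
  by exists 1; rewrite ?oner_neq0.
by exists 1 => [|x]; rewrite ?oner_neq0 // tofrac1 mul1r.
Qed.

Lemma ideal_subset I J : ideal I -> submod B J -> J `<=` I ->
  (exists2 x, J x & x != 0) -> ideal J.
Proof.
move=> [_ _ [d d0 dI]] Jm JI Jn0; split=> //; first by apply/submoduleE.
by exists d => // x /JI; apply: dI.
Qed.

Lemma ideal_integral_elt I : ideal I -> exists2 r : R, r != 0 & I r%:F.
Proof.
move=> [[_ _ IM] [x Ix x0] _].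
have [d d0 [r _ rE]] := denominator x.
exists r; last by rewrite rE; apply: IM.
by rewrite -tofrac_eq0 rE mulf_neq0 ?tofrac_eq0.
Qed.

Lemma scale_submod (a : K) I : submod B I -> submod B (scale a I).
Proof.
case=> I0 ID IM; split=> [|_ _ [x Ix <-] [y Iy <-]|b _ Bb [x Ix <-]].
- by exists 0; rewrite ?mulr0.
- by exists (x + y); [apply: ID|rewrite mulrDr].
- by exists (b * x); [apply: IM|rewrite mulrCA].
Qed.

Lemma scale_ideal (a : K) I : a != 0 -> ideal I -> ideal (scale a I).
Proof.
move=> a0 Ii; have [_ [x Ix x0] [d d0 dI]] := Ii.
have [s s0 sa] := denominator a.
split; first by apply/submoduleE/scale_submod/ideal_submod.
  by exists (a * x); [exists x|rewrite mulf_neq0].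
exists (s * d) => [|_ [y Iy <-]]; first by rewrite mulf_neq0.
rewrite tofracM (_ : _ * _ = (s%:F * a) * (d%:F * y)); last by ring.
by have [_ _] := base_submod; apply=> //; apply: dI.
Qed.

Lemma span_scale_base (a : K) gs : span B (map ( *%R a) gs) = scale a (span B gs).
Proof. exact: span_scale. Qed.

(** If [d I] is integral and [j] is in [J], then [j d] carries [I] into [J]. If [a] is in [I] and
    [e J] is integral, then [e a] is a common denominator. *)
Lemma colon_ideal I J : ideal I -> ideal J -> ideal (colon J I).
Proof.
move=> Ii Ji; have [Im _ [d d0 dI]] := Ii; have [[J0 JD JM] _ [e e0 eJ]] := Ji.
have [a a0 Ia] := ideal_integral_elt Ii.
have [j j0 Jj] := ideal_integral_elt Ji.
split.
- split=> [y _|x z Jx Jz y Iy|r x Jx y Iy]; first by rewrite mul0r.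
    by rewrite mulrDl; apply: (JD); [apply: Jx|apply: Jz].
  by rewrite -mulrA; apply: JM; apply: Jx.
- exists (j%:F * d%:F); last by rewrite mulf_neq0 ?tofrac_eq0.
  by move=> y /dI [r _ ry]; rewrite -mulrA -ry mulrC; apply: JM.
- exists (e * a) => [|x Jx]; first by rewrite mulf_neq0.
  by rewrite tofracM -mulrA [_ * x]mulrC; apply: eJ; apply: Jx.
Qed.

Lemma ideal_mul_min I J (X : set K) : submod B X ->
  (forall a b, I a -> J b -> X (a * b)) -> ideal_mul I J `<=` X.
Proof.
move=> [X0 XD XM] IJX _ [n [a [b [Ia Jb ->]]]].
by apply: big_ind => // i _; apply: IJX.
Qed.

Lemma ideal_mulM I J a b : I a -> J b -> ideal_mul I J (a * b).
Proof.
by move=> Ia Jb; exists 1%N, (fun=> a), (fun=> b); split=> //; rewrite big_ord1.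
Qed.

Lemma ideal_mul_submod I J : submod B I -> submod B (ideal_mul I J).
Proof.
case=> _ _ IM; split=> [|_ _ [n [a [b [Ia Jb ->]]]] [n' [a' [b' [Ia' Jb' ->]]]]|].
- by exists 0%N, (fun=> 0), (fun=> 0); split=> [[]//|[]//|]; rewrite big_ord0.
- pose f (u : 'I_n -> K) (v : 'I_n' -> K) (i : 'I_(n + n')) :=
    match split i with inl j => u j | inr j => v j end.
  exists (n + n')%N, (f a a'), (f b b'); split=> [i|i|].
  + by rewrite /f; case: (split i).
  + by rewrite /f; case: (split i).
  rewrite big_split_ord /f; congr (_ + _); apply: eq_bigr => i _.
    by rewrite (unsplitK (inl i : 'I_n + 'I_n')).
  by rewrite (unsplitK (inr i : 'I_n + 'I_n')).
- move=> c _ Bc [n [a [b [Ia Jb ->]]]].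
  exists n, (fun i => c * a i), b; split=> // [i|]; first exact: IM.
  by rewrite mulr_sumr; apply: eq_bigr => i _; rewrite mulrA.
Qed.

Lemma ideal_mul_ideal I J : ideal I -> ideal J -> ideal (ideal_mul I J).
Proof.
move=> Ii Ji; have [_ [x Ix x0] [d d0 dI]] := Ii.
have [_ [y Jy y0] [e e0 eJ]] := Ji.
split; first by apply/submoduleE/ideal_mul_submod/ideal_submod.
  by exists (x * y); [apply: ideal_mulM|rewrite mulf_neq0].
exists (d * e); first by rewrite mulf_neq0.
have [B0 BD BM] := base_submod.
have : ideal_mul I J `<=` [set z | B ((d * e)%:F * z)].
  apply: ideal_mul_min => [|a b Ia Jb /=].
    split=> /= [|a b Ba Bb|c z Bc Bz]; first by rewrite mulr0.
      by rewrite mulrDr; apply: BD.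
    by rewrite mulrCA; apply: BM.
  rewrite tofracM (_ : _ * _ = (d%:F * a) * (e%:F * b)); last by ring.
  by apply: BM; [apply: dI|apply: eJ].
by [].
Qed.

(** Only the set of generators matters, so the indexed families of [fg_ideal] can be traded for
    lists. *)
Lemma span_ordE n (g : 'I_n -> K) gs : codom g =i gs ->
  [set x | exists r : 'I_n -> R, x = \sum_i (r i)%:F * g i] = span B gs.
Proof.
move=> ggs; have [B0 _ _] := base_submod.
have [S0 SD _] := span_submod gs base_submod.
apply/seteqP; split=> [_ [r ->]|].
  apply: big_ind => // i _; apply: span_gen => //.
  by rewrite -ggs codom_f.
apply: (@span_min _ _ B) => [|_ h [r _ <-]].
  split=> [|_ _ [r ->] [s ->]|_ _ [c _ <-] [r ->]].
  - by exists (fun=> 0); rewrite big1 // => i _; rewrite tofrac0 mul0r.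
  - exists (fun i => r i + s i); rewrite -big_split; apply: eq_bigr => i _ /=.
    by rewrite tofracD mulrDl.
  - exists (fun i => c * r i); rewrite mulr_sumr; apply: eq_bigr => i _.
    by rewrite tofracM mulrA.
rewrite -ggs => /codomP [i ->]; exists (fun j => if j == i then r else 0).
rewrite (bigD1 i) //= eqxx big1 ?addr0 // => j /negPf ->.
by rewrite tofrac0 mul0r.
Qed.

Lemma fg_idealP J : fg_ideal J <-> ideal J /\ exists gs, J = span B gs.
Proof.
split=> -[Ji [n]]; last first.
  move=> JE; split=> //; exists (size n), (fun i => n`_i).
  rewrite JE; apply/esym/span_ordE => x; apply/codomP/idP => [[i ->]|xn].
    by rewrite mem_nth.
  by exists (Ordinal (etrans (index_mem x n) xn)); rewrite /= nth_index.
by case=> g JE; split=> //; exists (codom g); rewrite JE; apply: span_ordE.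
Qed.

Lemma span_mem gs g : g \in gs -> span B gs g.
Proof.
by move=> ggs; rewrite -[g]mul1r; apply: span_gen => //; case: base_submod.
Qed.

Lemma span_sub gs I : submod B I -> (forall g, g \in gs -> I g) -> span B gs `<=` I.
Proof.
by move=> Im gI; apply: (span_min Im) => b g Bb /gI Ig; have [_ _] := Im; apply.
Qed.

Lemma span_fg I gs : ideal I -> (forall g, g \in gs -> I g) ->
  (exists2 g, g \in gs & g != 0) -> fg_ideal (span B gs).
Proof.
move=> Ii gI [g ggs g0]; apply/fg_idealP; split; last by exists gs.
have Im := ideal_submod Ii.
apply: (ideal_subset Ii); first exact/span_submod/base_submod.
  exact: span_sub.
by exists g => //; apply: span_mem.
Qed.

(** Without a maximal member, choice provides a strictly larger member for each one, and iterating
    from [I0] contradicts the chain condition. *)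
Lemma acc_max (C D : set (set K)) I0 : acc C -> D `<=` C -> D I0 ->
  exists2 I, D I & forall J, D J -> I `<=` J -> J = I.
Proof.
move=> accC DC DI0; apply: contrapT => nmax.
have step (u : {I | D I}) : exists v : {I | D I}, sval u `<=` sval v /\ sval v <> sval u.
  case: u => I DI /=; apply: contrapT => nv; apply: nmax; exists I => // J DJ IJ.
  by apply: contrapT => JI; apply: nv; exists (exist _ J DJ).
have [f fP] := choice step.
pose u k := iter k f (exist _ I0 DI0).
have [n|n|N NP] := accC (fun n => sval (u n)).
- by apply: DC; apply: svalP.
- exact: (fP (u n)).1.
- by have := (fP (u N)).2; rewrite -(NP N.+1 (leqnSn _)).
Qed.

End FractionalIdeals.

(** * Localization at a prime *)

Section Localization.
Variables (R : idomainType) (M : set {fraction R}).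
Hypothesis Mprime : prime_ideal M.
Local Notation K := {fraction R}.
Local Notation B := (base_ring R).
Implicit Types (I J X : set K) (gs : seq K).

(** This is [I R_M] when [I] is a submodule, described by clearing one denominator rather than by
    sums of products. *)
Definition loc I : set K := [set x | exists2 s : R, ~ M s%:F & I (s%:F * x)].

Lemma prime_submod : submod B M.
Proof. by have [[/ideal_submod]] := Mprime. Qed.

Lemma prime_not1 : ~ M 1.
Proof.
move=> M1; have [[_ MB] nMB _] := Mprime; apply: nMB.
apply/seteqP; split=> // b Bb; rewrite -[b]mulr1.
by have [_ _] := prime_submod; apply.
Qed.

Lemma prime_nmul (s t : R) : ~ M s%:F -> ~ M t%:F -> ~ M (s * t)%:F.
Proof. by have [_ _ MP] := Mprime => Ms Mt /MP []. Qed.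

Lemma prime_nmem_neq0 (s : R) : ~ M s%:F -> s != 0.
Proof.
by move=> Ms; apply/eqP => s0; apply: Ms; rewrite s0 tofrac0; case: prime_submod.
Qed.

Lemma loc_mono I J : I `<=` J -> loc I `<=` loc J.
Proof. by move=> IJ x [s Ms /IJ Jx]; exists s. Qed.

Lemma sub_loc I : I `<=` loc I.
Proof.
by move=> x Ix; exists 1; rewrite tofrac1 ?mul1r //; apply: prime_not1.
Qed.

Lemma loc_submod I : submod B I -> submod (loc B) (loc I).
Proof.
move=> [I0 ID IM]; split=> [|x y [s Ms Ix] [t Mt Iy]|a x [s Ms Ba] [t Mt Ix]].
- exact: sub_loc.
- exists (s * t); first exact: prime_nmul.
  rewrite tofracM (_ : _ * _ = t%:F * (s%:F * x) + s%:F * (t%:F * y)); last by ring.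
  by apply: ID; apply: IM => //; apply: base_tofrac.
- exists (s * t); first exact: prime_nmul.
  rewrite tofracM (_ : _ * _ = (s%:F * a) * (t%:F * x)); last by ring.
  exact: IM.
Qed.

Lemma loc_subring : subring (loc B).
Proof.
split; [exact/sub_loc/base1| |exact/loc_submod/base_submod].
by apply: sub_loc; have [] := base_subring R.
Qed.

Lemma localizationE : localization M = loc B.
Proof.
apply/seteqP; split=> [_ [r [s [Ms ->]]]|x [s Ms [r _ rE]]].
  exists s => //; rewrite mulrC divfK ?tofrac_eq0 ?prime_nmem_neq0 //.
  exact: base_tofrac.
exists r, s; split=> //; rewrite rE [_ * x]mulrC mulfK //.
by rewrite tofrac_eq0 prime_nmem_neq0.
Qed.

(** If [s a = r] with [s] outside [M], then [r] is outside [M] as well, and [r a^-1 = s]. *)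
Lemma loc_unit a : loc B a -> ~ loc M a -> loc B a^-1 /\ a != 0.
Proof.
move=> [s Ms [r _ rE]] Ma.
have Mr : ~ M r%:F by move=> Mr; apply: Ma; exists s; rewrite -?rE.
have a0 : a != 0.
  apply/eqP => a0; apply: Mr; rewrite rE a0 mulr0; by case: prime_submod.
split=> //; exists r => //; rewrite rE mulfK //; exact: base_tofrac.
Qed.

Lemma loc_not1 : ~ loc M 1.
Proof. by case=> s Ms; rewrite mulr1. Qed.

Lemma common_denominator I gs : submod B I -> (forall g, g \in gs -> loc I g) ->
  exists2 s : R, ~ M s%:F & forall g, g \in gs -> I (s%:F * g).
Proof.
move=> [_ _ IM]; elim: gs => [|g gs IH] H.
  by exists 1; rewrite // tofrac1; apply: prime_not1.
have [h hgs|s Ms sP] := IH; first by apply: H; rewrite in_cons hgs orbT.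
have [t Mt tg] := H _ (mem_head _ _).
exists (s * t); first exact: prime_nmul.
move=> h; rewrite in_cons tofracM => /orP[/eqP->|/sP Ish].
  by rewrite -mulrA; apply: IM => //; apply: base_tofrac.
by rewrite mulrAC mulrC; apply: IM => //; apply: base_tofrac.
Qed.

Lemma ideal_mul_loc I X : submod (loc B) X -> I `<=` X ->
  ideal_mul I (localization M) `<=` X.
Proof.
move=> [X0 XD XM] IX; rewrite localizationE; apply: ideal_mul_min.
  by split=> // b x Bb; apply: XM; apply: sub_loc.
by move=> a b /IX Xa Lb; rewrite mulrC; apply: XM.
Qed.

End Localization.

(** * Star operations *)

Section StarOperation.
Variables (R : idomainType) (st : set {fraction R} -> set {fraction R}).
Hypothesis st_star : star_operation st.
Local Notation K := {fraction R}.
Local Notation B := (base_ring R).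
Implicit Types (I J F P M X : set K) (gs : seq K).

(** Scaling and monotonicity, with idempotence absorbing the second closure. The scaling axiom
    excludes [a = 0], which is treated apart. *)
Lemma star_scaleW I J (a x : K) : ideal I -> ideal J ->
  (forall y, I y -> st J (a * y)) -> st I x -> st J (a * x).
Proof.
move=> Ii Ji aIJ stx; have stJ := star_ideal st_star Ji.
have [->|a0] := eqVneq a 0; first by rewrite mul0r; case: (ideal_submod stJ).
have : st (scale a I) `<=` st (st J).
  apply: (star_mono st_star) => //; first exact: scale_ideal.
  by move=> _ [y Iy <-]; apply: aIJ.
rewrite (star_idem st_star) // (star_scale st_star) //; apply.
by exists x.
Qed.

Lemma star_subset I J : ideal I -> ideal J -> I `<=` st J -> st I `<=` st J.
Proof.
move=> Ii Ji IJ x Ix; rewrite -[x]mul1r; apply: star_scaleW Ix => //.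
by move=> y; rewrite mul1r; apply: IJ.
Qed.

Lemma star_integral I : ideal I -> I `<=` B -> st I `<=` B.
Proof.
move=> Ii IB; rewrite -(star_base st_star).
by apply: (star_mono st_star) => //; apply: ideal_base.
Qed.

Lemma star_integral_starred I :
  integral_ideal I -> integral_ideal (st I) /\ starred st (st I).
Proof.
move=> [Ii IB]; have sti := star_ideal st_star Ii.
split; split=> //; first exact: star_integral.
by rewrite (star_idem st_star).
Qed.

(** Among the finitely generated [F] inside [I], one has a maximal closure; adding any [y] of [I] to
    its generators does not enlarge that closure. The factor [d] makes the closures integral, as the
    chain condition requires. *)
Lemma star_fg_cover I x : star_noetherian st -> ideal I -> st I x ->
  exists F, [/\ fg_ideal F, F `<=` I & st F x].
Proof.
move=> noeth Ii Ix; have [_ [z Iz z0] [d d0 dI]] := Ii.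
have d0' : d%:F != 0 by rewrite tofrac_eq0.
pose D := [set st (scale d%:F F) | F in [set F | fg_ideal F /\ F `<=` I]].
have Fz : fg_ideal (span B [:: z]).
  apply: (span_fg Ii) => [g|]; first by rewrite inE => /eqP ->.
  by exists z; rewrite ?mem_head.
have [||_ [F [Ffg FI] <-] Fmax] := @acc_max R _ D (st (scale d%:F (span B [:: z]))) noeth.
- move=> _ [F [/fg_idealP [Fi _] FI] <-].
  apply: star_integral_starred; split; first exact: scale_ideal.
  by move=> _ [y /FI/dI By <-].
- exists (span B [:: z]) => //; split=> //; apply: span_sub; first exact: ideal_submod.
  by move=> g; rewrite inE => /eqP ->.
have Fi : ideal F by case/fg_idealP: Ffg.
exists F; split=> //; have stF := star_ideal st_star Fi.
suff: st I `<=` st F by apply.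
apply: star_subset => // y Iy.
have [_ [gs FE]] := (fg_idealP F).1 Ffg.
have yFI g : g \in y :: gs -> I g.
  by rewrite in_cons => /orP[/eqP->//|ggs]; apply: FI; rewrite FE; apply: span_mem.
have FF' : F `<=` span B (y :: gs).
  rewrite FE; apply: span_sub; first exact/span_submod/base_submod.
  by move=> g ggs; apply: span_mem; rewrite in_cons ggs orbT.
have F'i : ideal (span B (y :: gs)).
  apply: (ideal_subset Ii); first exact/span_submod/base_submod.
    by apply: span_sub => //; apply: ideal_submod.
  by have [_ [f Ff f0] _] := Fi; exists f => //; apply: FF'.
have F'E : st (scale d%:F (span B (y :: gs))) = st (scale d%:F F).
  apply: Fmax.
    exists (span B (y :: gs)) => //; split.
      by apply/fg_idealP; split=> //; exists (y :: gs).
    by apply: span_sub => //; apply: ideal_submod.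
  apply: (star_mono st_star); [exact: scale_ideal|exact: scale_ideal|].
  by move=> _ [f /FF' Ff <-]; exists f.
have : scale d%:F (st F) (d%:F * y).
  rewrite -(star_scale st_star) // -F'E; apply: (star_sub st_star).
    exact: scale_ideal.
  by exists y => //; apply: span_mem; rewrite mem_head.
by case=> u Fu /(mulfI d0') <-.
Qed.

Lemma star_f_noetherian I : star_noetherian st -> ideal I -> star_f st I = st I.
Proof.
move=> noeth Ii; apply/seteqP; split=> [x [F [Ffg FI] Fx]|x Ix].
  by apply: (star_mono st_star) Fx => //; case/fg_idealP: Ffg.
by have [F [Ffg FI Fx]] := star_fg_cover noeth Ii Ix; exists F.
Qed.

Lemma star_max_above I : star_noetherian st -> proper_integral_star_ideal st I ->
  exists2 M, star_max st M & I `<=` M.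
Proof.
move=> noeth Ip.
have [||M [Mp IM] Mmax] := @acc_max R _
    [set J | proper_integral_star_ideal st J /\ I `<=` J] I noeth.
- by move=> J [[? ? _] _].
- by split.
exists M => //; split=> // J Jp MJ; apply: Mmax => //; split=> //.
exact: subset_trans MJ.
Qed.

Lemma add_principal_submod I (x : K) : submod B I ->
  submod B [set y | exists a b, [/\ I a, B b & y = a + b * x]].
Proof.
have [B0 BD BM] := base_submod R.
case=> I0 ID IM.
split=> [|_ _ [a [b [Ia Bb ->]]] [c [d [Ic Bd ->]]]|r _ Br [a [b [Ia Bb ->]]]].
- by exists 0, 0; rewrite mul0r addr0.
- by exists (a + c), (b + d); split; [apply: ID|apply: BD|ring].
- by exists (r * a), (r * b); split; [apply: IM|apply: BM|ring].
Qed.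

(** If [x] is outside [M], the closure of [M + R x] contains 1 by maximality. Since [y (M + R x)]
    lies in [M], so does [y]. *)
Lemma star_max_prime M : star_max st M -> prime_ideal M.
Proof.
move=> [[[Mi MB] [_ ME] nMB] Mmax]; split=> // x y Mxy.
apply: contrapT => /not_orP[Mx My].
have Mm := ideal_submod Mi; have [M0 MD MM] := Mm.
have [B0 BD BM] := base_submod R.
pose I := [set z | exists a b, [/\ M a, B b & z = a + b * x%:F]].
have Im : submod B I := add_principal_submod x%:F Mm.
have MI : M `<=` I by move=> a Ma; exists a, 0; rewrite mul0r addr0.
have IB : I `<=` B.
  move=> _ [a [b [/MB Ba Bb ->]]]; apply: BD => //; apply: BM => //.
  exact: base_tofrac.
have Ii : ideal I.
  apply: (ideal_subset (ideal_base R)) => //.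
  by have [_ [m Mm' m0] _] := Mi; exists m => //; apply: MI.
have [stIi stIs] := star_integral_starred (conj Ii IB).
have II := star_sub st_star Ii.
have stI1 : st I 1.
  apply: contrapT => I1; apply: Mx.
  rewrite -(Mmax (st I)); first apply: (II).
  - by exists 0, 1; rewrite mul1r add0r; split=> //; apply: base1.
  - by split=> // E; apply: I1; rewrite E; apply: base1.
  - exact: subset_trans II.
apply: My; rewrite ME -[y%:F]mulr1; apply: star_scaleW stI1 => //.
move=> _ [a [b [Ma Bb ->]]]; rewrite -ME mulrDr; apply: MD.
  by apply: MM => //; apply: base_tofrac.
by rewrite mulrCA -tofracM [y * x]mulrC; apply: MM.
Qed.

End StarOperation.

(** This lets a condition on finitely generated ideals pass to the union of a chain. *)
Lemma chain_cover (T : eqType) (F : set (set T)) (X0 : set T) (gs : seq T) :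
  total_on F subset -> F X0 -> (forall g, g \in gs -> exists2 X, F X & X g) ->
  exists2 X, F X & forall g, g \in gs -> X g.
Proof.
move=> Ftot FX0; elim: gs => [|g gs IH] H; first by exists X0.
have [h hgs|X FX Xgs] := IH; first by apply: H; rewrite in_cons hgs orbT.
have [Y FY Yg] := H g (mem_head _ _).
have [XY|YX] := Ftot _ _ FX FY.
  by exists Y => // h; rewrite in_cons => /orP[/eqP->//|/Xgs/XY].
by exists X => // h; rewrite in_cons => /orP[/eqP->|/Xgs//]; apply: YX.
Qed.

(** * Maximal ideals for [star_f st], and comparison of [star_tilde st] with [st] *)

Section StarTilde.
Variables (R : idomainType) (st : set {fraction R} -> set {fraction R}).
Hypothesis st_star : star_operation st.
Local Notation K := {fraction R}.
Local Notation B := (base_ring R).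
Implicit Types (I J F P M X : set K) (gs : seq K).

(** The second condition says that 1 is not in [star_f st I]. In this form Zorn's lemma applies
    without [star_f st] being known to be a star operation. *)
Definition star_f_proper I : Prop :=
  integral_ideal I /\ forall F, fg_ideal F -> F `<=` I -> ~ st F 1.

Lemma star_f_proper_maximal J : star_f_proper J ->
  exists M, [/\ star_f_proper M, J `<=` M &
    forall I, star_f_proper I -> M `<=` I -> I = M].
Proof.
move=> Jp.
(* The union with [J] accounts for the empty chain, whose union is empty, and keeps the maximal
   element above [J]. *)
have [|M [Mp Mmax]] := @Zorn_bigcup K [set I | star_f_proper (I `|` J)]; last first.
  exists (M `|` J); split=> // I Ip MI.
  apply: contrapT => IM; apply: (Mmax I); last first.
    by rewrite /= (_ : I `|` J = I) //; apply/setUidPl => x Jx; apply: MI; right.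
  split=> [x Mx|IM']; first by apply: MI; left.
  by apply: IM; apply/seteqP; split=> // x /IM'; left.
move=> C CP Ctot.
pose G := [set I | I = J \/ exists2 X, C X & I = X `|` J].
have Gp I : G I -> star_f_proper I by case=> [->//|[X /CP ? ->]].
have Gtot : total_on G subset.
  move=> _ _ [->|[X CX ->]] [->|[Y CY ->]]; [by left|by left; right|by right; right|].
  by case: (Ctot X Y CX CY) => XY; [left|right]; apply: setSU.
have GJ : G J by left.
pose U := \bigcup_(X in C) X `|` J.
have UG x : U x -> exists2 X, G X & X x.
  case=> [[X CX Xx]|Jx]; last by exists J.
  by exists (X `|` J); [right; exists X|left].
have GU X : G X -> X `<=` U.
  case=> [->|[Y CY ->]]; first by right.
  by move=> x [Yx|Jx]; [left; exists Y|right].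
have Um : submod B U.
  split=> [|x y Ux Uy|b x Bb /UG [X GX Xx]].
  - by right; have [[/ideal_submod []]] := Jp.
  - have [|X GX XP] := @chain_cover _ G J [:: x; y] Gtot GJ.
      by move=> g; rewrite !inE => /orP[]/eqP->; apply: UG.
    have [[/ideal_submod [_ XD _] _] _] := Gp _ GX.
    by apply: (GU X) => //; apply: XD; apply: XP; rewrite !inE eqxx ?orbT.
  - have [[/ideal_submod [_ _ XM] _] _] := Gp _ GX.
    by apply: (GU X) => //; apply: XM.
have UB : U `<=` B by move=> x /UG [X /Gp [[_ XB] _]]; apply: XB.
split=> [|F Ffg FU F1].
  split=> //; apply: (ideal_subset (ideal_base R)) => //.
  by have [[[_ [x Jx x0] _] _] _] := Jp; exists x => //; right.
have [_ [gs FE]] := (fg_idealP F).1 Ffg.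
have [g ggs|X GX Xgs] := @chain_cover _ G J gs Gtot GJ.
  by apply/UG/FU; rewrite FE; apply: span_mem.
have [[Xi _] XP] := Gp _ GX.
by apply: (XP F) => //; rewrite FE; apply: span_sub => //; apply: ideal_submod.
Qed.

Section Maximal.
Variable M : set K.
Hypothesis Mp : star_f_proper M.
Hypothesis Mmax : forall I, star_f_proper I -> M `<=` I -> I = M.

Let Mm : submod B M. Proof. by case: Mp => -[/ideal_submod]. Qed.

(** By maximality [M + R x] contains a finitely generated [F] whose closure contains 1; [gs]
    collects the components in [M] of the generators of [F]. *)
Lemma star_f_maximal_cover (x : K) : B x -> ~ M x ->
  exists gs, [/\ forall g, g \in gs -> M g, fg_ideal (span B (x :: gs)) &
    st (span B (x :: gs)) 1].
Proof.
move=> Bx Mx; have [M0 MD MM] := Mm; have [[Mi MB] _] := Mp.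
have [B0 BD BM] := base_submod R.
pose I := [set z | exists a b, [/\ M a, B b & z = a + b * x]].
have Im : submod B I := add_principal_submod x Mm.
have MI : M `<=` I by move=> a Ma; exists a, 0; rewrite mul0r addr0.
have IB : I `<=` B by move=> _ [a [b [/MB Ba Bb ->]]]; apply: BD => //; apply: BM.
have Ii : ideal I.
  apply: (ideal_subset (ideal_base R)) => //.
  by have [_ [m Mm' m0] _] := Mi; exists m => //; apply: MI.
have [F [Ffg FI F1]] : exists F, [/\ fg_ideal F, F `<=` I & st F 1].
  apply: contrapT => nF; apply: Mx; rewrite -(Mmax (I := I)) //.
    by exists 0, 1; rewrite add0r mul1r; split=> //; apply: base1.
  by split=> // F Ffg FI F1; apply: nF; exists F.
have [Fi [hs FE]] := (fg_idealP F).1 Ffg.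
have [gs Mgs hsP] : exists2 gs, forall g, g \in gs -> M g &
    forall h, h \in hs -> span B (x :: gs) h.
  have : forall h, h \in hs -> I h by move=> h hhs; apply: FI; rewrite FE; apply: span_mem.
  elim: hs {FE} => [|h hs IH] H; first by exists [::].
  have [h' h'hs|gs Mgs hsP] := IH; first by apply: H; rewrite in_cons h'hs orbT.
  have [a [b [Ma Bb hE]]] := H h (mem_head _ _).
  exists (a :: gs) => [g|k]; first by rewrite in_cons => /orP[/eqP->//|/Mgs].
  have Sm := span_submod (x :: a :: gs) (base_submod R); have [S0 SD SM] := Sm.
  rewrite in_cons => /orP[/eqP->|/hsP].
    rewrite hE; apply: SD; first by apply: span_mem; rewrite !inE eqxx orbT.
    by apply: SM => //; apply: span_mem; rewrite mem_head.
  apply: (span_sub Sm) => g; rewrite in_cons => ggs; apply: span_mem.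
  rewrite !in_cons.
  by case/orP: ggs => ->; rewrite ?orbT.
have Gfg : fg_ideal (span B (x :: gs)).
  apply: (span_fg (ideal_base R)) => [g|].
    by rewrite in_cons => /orP[/eqP->//|/Mgs/MB].
  by exists x; rewrite ?mem_head //; apply/eqP => x0; apply: Mx; rewrite x0.
exists gs; split=> //; apply: (star_mono st_star) F1 => //; first by case: Gfg.
by rewrite FE; apply: span_sub => //; apply/span_submod/base_submod.
Qed.

(** If [x] were outside [M], the previous lemma would put 1 in the closure of some [(x, gs)] with
    [gs] in [M]. As [x] is in the closure of [F], the generators of [F] can replace it, and 1 is in
    the closure of a finitely generated ideal inside [M]. *)
Lemma star_f_maximal_closed F x : fg_ideal F -> F `<=` M -> st F x -> M x.
Proof.
move=> Ffg FM Fx; apply: contrapT => Mx; have [[Mi MB] M1] := Mp.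
have [Fi [fs FE]] := (fg_idealP F).1 Ffg.
have Bx : B x by apply: (star_integral st_star Fi) Fx; apply: subset_trans MB.
have [gs [Mgs [xgsi _] xgs1]] := star_f_maximal_cover Bx Mx.
have GM g : g \in fs ++ gs -> M g.
  rewrite mem_cat => /orP[gfs|/Mgs//].
  by apply: FM; rewrite FE; apply: span_mem.
have Gm : submod B (span B (fs ++ gs)) by apply/span_submod/base_submod.
have FG : F `<=` span B (fs ++ gs).
  by rewrite FE; apply: span_sub => // g gfs; apply: span_mem; rewrite mem_cat gfs.
have Gi : ideal (span B (fs ++ gs)).
  apply: (ideal_subset Mi) => //; first exact: span_sub.
  by have [_ [f Ff f0] _] := Fi; exists f => //; apply: FG.
apply: (M1 (span B (fs ++ gs))).
- by apply/fg_idealP; split=> //; exists (fs ++ gs).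
- exact: span_sub.
apply: (star_subset st_star xgsi Gi) xgs1.
apply: span_sub; first exact/ideal_submod/(star_ideal st_star).
move=> g; rewrite in_cons => /orP[/eqP->|ggs].
  exact: (star_mono st_star Fi Gi).
by apply: (star_sub st_star) => //; apply: span_mem; rewrite mem_cat ggs orbT.
Qed.

Lemma star_f_maximal_prime : prime_ideal M.
Proof.
have [[Mi MB] M1] := Mp; have [M0 MD MM] := Mm.
split=> // [MBE|x y Mxy].
  apply: (M1 B) => //; last by rewrite (star_base st_star); apply: base1.
    apply/fg_idealP; split; first exact: ideal_base.
    exists [:: 1]; apply/seteqP; split=> [b Bb|].
      by rewrite -[b]mulr1; have [_ _] := span_submod [:: 1] (base_submod R);
        apply=> //; apply: span_mem; rewrite mem_head.
    apply: span_sub; first exact: base_submod.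
    by move=> g; rewrite inE => /eqP->; apply: base1.
  by rewrite MBE.
apply: contrapT => /not_orP[Mx My].
have [gs [Mgs xgs xgs1]] := star_f_maximal_cover (base_tofrac x) Mx.
have y0 : y%:F != 0 by apply/eqP => y0; apply: My; rewrite y0.
have [xgsi _] := xgs.
(* The ideal [y (x, gs)] lies in [M], since [x y] and [gs] do, and its closure contains [y * 1]. *)
apply: My; apply: (@star_f_maximal_closed (scale y%:F (span B (x%:F :: gs)))).
- apply/fg_idealP; split; first exact: scale_ideal.
  by exists (map ( *%R y%:F) (x%:F :: gs)); rewrite span_scale_base.
- rewrite -span_scale_base; apply: span_sub => // _ /mapP[g + ->].
  rewrite in_cons => /orP[/eqP->|/Mgs Mg].
    by rewrite -tofracM mulrC.
  by apply: MM => //; apply: base_tofrac.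
- by rewrite (star_scale st_star) //; exists 1; rewrite ?mulr1.
Qed.

Lemma star_f_maximal_star_max : star_max (star_f st) M.
Proof.
have [[Mi MB] M1] := Mp.
have ME : M = star_f st M.
  apply/seteqP; split=> [x Mx|x [F [Ffg FM] Fx]]; last first.
    exact: star_f_maximal_closed Ffg FM Fx.
  have [_ [z Mz z0] _] := Mi.
  have gsM g : g \in [:: x; z] -> M g by rewrite !inE => /orP[]/eqP->.
  (* The nonzero [z] keeps the ideal nonzero when [x = 0]. *)
  exists (span B [:: x; z]).
    split; last exact: span_sub.
    by apply: (span_fg Mi) => //; exists z; rewrite // !inE eqxx orbT.
  apply: (star_sub st_star); last by apply: span_mem; rewrite mem_head.
  have /fg_idealP [] // : fg_ideal (span B [:: x; z]).
  by apply: (span_fg Mi) => //; exists z; rewrite // !inE eqxx orbT.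
split.
  split=> //; have [_ nMB _] := star_f_maximal_prime; exact: nMB.
move=> J [[Ji JB] [_ JE] nJB] MJ; apply: Mmax => //; split=> // F Ffg FJ F1.
apply: nJB; apply/seteqP; split=> // b Bb; rewrite -[b]mulr1.
by have [_ _] := ideal_submod Ji; apply=> //; rewrite JE; exists F.
Qed.

End Maximal.

(** Let [J] be the ideal of all [r] in [R] with [r x] in [I]. No maximal [M] for [star_f st]
    contains [J], because [x] in [I R_M] gives an [s] outside [M] with [s x] in [I]. Hence 1 is in
    the closure of a finitely generated [F] inside [J], and [F x] is contained in [I]. *)
Lemma star_tilde_sub I : ideal I -> star_tilde st I `<=` st I.
Proof.
move=> Ii x tx; have Im := ideal_submod Ii; have [I0 ID IM] := Im.
have [B0 BD BM] := base_submod R.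
pose J := [set r | B r /\ I (r * x)].
have Jm : submod B J.
  split=> [|r s [Br Ir] [Bs Is]|b r Bb [Br Ir]]; first by rewrite /J /= mul0r.
    by split; [apply: BD|rewrite mulrDl; apply: ID].
  by split; [apply: BM|rewrite -mulrA; apply: IM].
have Ji : ideal J.
  apply: (ideal_subset (ideal_base R)) => // [r []//|].
  have [a a0 Ia] := ideal_integral_elt Ii.
  have [s s0 [r _ rE]] := denominator x.
  (* Here [s x = r] is in [R] and [a] is in [I], so [s a x = r a] is in [I]. *)
  exists (s * a)%:F; last by rewrite tofrac_eq0 mulf_neq0.
  split; first exact: base_tofrac.
  rewrite tofracM -mulrA [_ * x]mulrC mulrA -rE; apply: IM => //.
  exact: base_tofrac.
have [F [Ffg FJ F1]] : exists F, [/\ fg_ideal F, F `<=` J & st F 1].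
  apply: contrapT => nF.
  have [|M [Mp JM Mmax]] := @star_f_proper_maximal J.
    split; first by split=> // r [].
    by move=> F Ffg FJ F1; apply: nF; exists F.
  have Mprime := star_f_maximal_prime Mp Mmax.
  have Lm := loc_submod Mprime Im.
  have := tx M (star_f_maximal_star_max Mp Mmax).
  move=> /(ideal_mul_loc Mprime Lm (sub_loc Mprime (I:=I))) [s Ms Isx].
  by apply: Ms; apply: JM; split=> //; apply: base_tofrac.
rewrite -[x]mulr1; apply: (star_scaleW st_star) F1 => //; first by case: Ffg.
by move=> r /FJ [_ Irx]; rewrite mulrC; apply: (star_sub st_star).
Qed.

Lemma sub_ideal_mul_localization I M : ~ M 1 -> I `<=` ideal_mul I (localization M).
Proof.
move=> M1 x Ix; rewrite -[x]mulr1; apply: ideal_mulM => //.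
by exists 1, 1; rewrite tofrac1 divr1.
Qed.

Lemma star_max_not1 (s : set K -> set K) M : star_max s M -> ~ M 1.
Proof.
move=> [[[Mi MB] _ nMB] _] M1; apply: nMB; apply/seteqP; split=> // b Bb.
by rewrite -[b]mulr1; have [_ _] := ideal_submod Mi; apply.
Qed.

Lemma sub_star_tilde I : I `<=` star_tilde st I.
Proof.
by move=> x Ix M /star_max_not1 M1; apply: sub_ideal_mul_localization.
Qed.

(** An ideal closed under [st] is squeezed between its [star_tilde] closure and itself. *)
Lemma star_noetherian_of_tilde : star_noetherian (star_tilde st) -> star_noetherian st.
Proof.
move=> noeth I IP; apply: noeth => n; have [Iint [Ii IE]] := IP n.
split=> //; split=> //; apply/seteqP; split; first exact: sub_star_tilde.
by rewrite {2}IE; apply: star_tilde_sub.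
Qed.

(** Nonzero ideals of [R_M] contract to ideals of [R] closed under [star_tilde st]. A finitely
    generated submodule of [X] with maximal contraction is all of [X], since an ideal of [R_M] is
    determined by its contraction. *)
Lemma localization_noetherian M : star_noetherian (star_tilde st) ->
    star_max (star_f st) M -> prime_ideal M ->
  forall X, submod (loc M B) X -> X `<=` loc M B ->
    exists gs, X = span (loc M B) gs.
Proof.
move=> noeth Mmax Mp X Xm XA; have [X0 XD XM] := Xm.
have Ar := loc_subring Mp; have [A1 _ Am] := Ar; have [A0 AD AM] := Am.
have [B0 BD BM] := base_submod R.
(* The zero ideal is set apart because ideals of [R] are nonzero by definition. *)
case: (pselect (exists2 z, X z & z != 0)) => [[z Xz z0]|nX]; last first.
  exists [::]; apply/seteqP; split=> [x Xx|_ ->//] /=; apply: contrapT => /eqP x0.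
  by apply: nX; exists x.
pose D := [set span (loc M B) gs `&` B | gs in
  [set gs : seq K | (forall g : K, g \in gs -> X g) /\ exists2 g, g \in gs & g != 0]].
have [||_ [gs [gsX [g ggs g0]] <-] gsmax] :=
    @acc_max R _ D (span (loc M B) [:: z] `&` B) noeth.
- move=> _ [gs [gsX [g ggs g0]] <-].
  have Sm := span_submod gs Am; have [S0 SD SM] := Sm.
  have [s Ms Bsg] := XA _ (gsX _ ggs).
  have Yi : ideal (span (loc M B) gs `&` B).
    apply: (ideal_subset (ideal_base R)) => [|x []//|].
      split=> [//|x y [? ?] [? ?]|b x Bb [? ?]]; split; auto.
      by apply: SM => //; apply: sub_loc.
    exists (s%:F * g); last by rewrite mulf_neq0 // tofrac_eq0 (prime_nmem_neq0 Mp).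
    by split=> //; apply: span_gen => //; apply/sub_loc/base_tofrac.
  split; split=> //; apply/seteqP; split; first exact: sub_star_tilde.
  move=> x tx; split.
    by apply: (ideal_mul_loc Mp Sm) (tx M Mmax) => y [].
  apply: (star_integral st_star Yi); first by move=> y [].
  exact: star_tilde_sub.
- exists [:: z] => //; split; first by move=> g; rewrite inE => /eqP->.
  by exists z; rewrite ?mem_head.
exists gs; have Sm := span_submod gs Am; have [S0 SD SM] := Sm.
apply/seteqP; split; last first.
  by apply: (span_min Xm) => b h Ab /gsX; apply: XM.
move=> x Xx; have [s Ms Bsx] := XA _ Xx.
have sx : (span (loc M B) (x :: gs) `&` B) (s%:F * x).
  split=> //; apply: span_gen; rewrite ?mem_head //.
  exact/sub_loc/base_tofrac.
rewrite (gsmax (span (loc M B) (x :: gs) `&` B)) in sx.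
- have s0 : s%:F != 0 by rewrite tofrac_eq0 (prime_nmem_neq0 Mp).
  rewrite -[x](mulKf s0); apply: SM; last by case: sx.
  by exists s => //; rewrite mulfV //; apply: base1.
- exists (x :: gs) => //; split; last by exists g; rewrite // in_cons ggs orbT.
  by move=> h; rewrite in_cons => /orP[/eqP->//|/gsX].
- move=> y [Sy By]; split=> //; apply: (span_min (B := loc M B)) Sy.
    exact: span_submod.
  by move=> b h Ab hgs; apply: span_gen; rewrite // in_cons hgs orbT.
Qed.

(* Localizing at [M] turns *-stability of [M] into the hypothesis of
   [stable_local_dim1] because [1] already lies in [F^*] for a finitely
   generated [F] contained in [M (E : M)]. *)
Lemma stable_star_max_height1 M P : star_noetherian (star_tilde st) ->
    star_max st M -> star_stable_ideal st M -> prime_ideal P -> P `<=` M ->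
  P = M.
Proof.
move=> tnoeth Mmax; rewrite /star_stable_ideal.
have noeth := star_noetherian_of_tilde tnoeth.
have Mp := star_max_prime st_star Mmax.
have [[[Mi MB] [_ ME] nMB] _] := Mmax; rewrite -ME.
set E := colon M M; set N := colon E M => stE Pp PM.
(* The two operations agree on ideals, as [st] has finite type; this makes [localization_noetherian]
   available at [M]. *)
have Mfmax : star_max (star_f st) M.
  split; first by split=> //; split=> //; rewrite star_f_noetherian.
  move=> J [Jint [Ji JE] nJB]; case: Mmax => _; apply; split=> //.
  by split=> //; rewrite -star_f_noetherian.
have Mm := ideal_submod Mi; have [M0 MD MM] := Mm.
have Ei : ideal E by apply: colon_ideal.
have Ni : ideal N by apply: colon_ideal.
have Qi : ideal (ideal_mul M N) by apply: ideal_mul_ideal.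
have Q1 : st (ideal_mul M N) 1 by rewrite stE => x; rewrite mul1r.
have [F [Ffg FQ F1]] := star_fg_cover st_star noeth Qi Q1.
have [Fi [fs FE]] := (fg_idealP F).1 Ffg.
have lMm := loc_submod Mp Mm.
have Pm := prime_submod Pp; have [_ _ Pprime] := Pp.
apply/seteqP; split=> // x Mx.
suff: loc M P x.
  have [r _ <-] := MB _ Mx.
  case=> s Ms; rewrite -tofracM => /Pprime [Ps|//].
  by case: Ms; apply: PM.
suff lMP : loc M M `<=` loc M P by apply/lMP/sub_loc.
apply: (@stable_local_dim1 _ (loc M B) (loc M M)).
- exact: loc_subring.
- exact: lMm.
- exact: loc_mono.
- exact: loc_not1.
- exact: loc_unit.
- exact: localization_noetherian.
- move=> y yN.
  have [lM0 lMD lMM] := lMm.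
  have yF f : f \in map ( *%R y) fs -> loc M M f.
    move=> /mapP[g gfs ->].
    have : ideal_mul M N g by apply: FQ; rewrite FE; apply: span_mem.
    have : ideal_mul M N `<=` [set g | loc M M (y * g)].
      apply: ideal_mul_min => [|a n Ma Nn /=].
        split=> /= [|u v ? ?|b u Bb ?]; first by rewrite mulr0.
          by rewrite mulrDr; apply: lMD.
        by rewrite mulrCA; apply: lMM => //; apply: sub_loc.
      apply: yN; first exact: sub_loc.
      move=> b c [s Ms Msb] [t Mt Mtc]; exists (s * t); first exact: prime_nmul.
      rewrite tofracM (_ : _ * _ = n * (s%:F * b) * (t%:F * c)); last by ring.
      exact: Nn.
    by move=> H /H.
  (* One [s] outside [M] carries all of [y F] into [M]; taking closures, [s y = s y * 1] is in
     [M]. *)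
  have [s Ms sP] := common_denominator Mp Mm yF.
  exists s => //; rewrite ME -[_ * y]mulr1.
  apply: (star_scaleW st_star Fi Mi) F1 => g.
  have : F `<=` [set g | M (s%:F * y * g)].
    rewrite FE; apply: span_sub => [|h hfs /=].
      split=> /= [|u v ? ?|b u Bb ?]; first by rewrite mulr0.
        by rewrite mulrDr; apply: MD.
      by rewrite mulrCA; apply: MM.
    by rewrite -mulrA; apply: sP; apply: map_f.
  by move=> H /H; rewrite -ME.
- exact: loc_submod.
- exact: loc_mono.
- move=> a b [s Ms [r _ rE]] [t Mt [q _ qE]] [u Mu Pab].
  have : P ((u * (r * q))%:F).
    rewrite !tofracM rE qE.
    rewrite (_ : _ * _ = (s * t)%:F * (u%:F * (a * b))); last by rewrite tofracM; ring.
    by have [_ _ PMul] := Pm; apply: PMul => //; apply: base_tofrac.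
  case/Pprime => [/PM//|]; case/Pprime => [Pr|Pq]; [left; exists s|right; exists t] => //.
    by rewrite -rE.
  by rewrite -qE.
- have [[[_ [p Pp' p0] _] _] _ _] := Pp.
  by exists p => //; apply: sub_loc.
Qed.

End StarTilde.

(** * Dimension *)

Section DivisorialClosure.
Variable R : idomainType.
Local Notation K := {fraction R}.
Local Notation B := (base_ring R).
Implicit Types (I J : set K) (st : set K -> set K).

Lemma colon_subset (H I J : set K) : I `<=` J -> colon H J `<=` colon H I.
Proof. by move=> IJ x Hx y /IJ; apply: Hx. Qed.

Lemma colon_scale (H : set K) (a : K) I : a != 0 ->
  colon H (scale a I) = scale a^-1 (colon H I).
Proof.
move=> a0; apply/seteqP; split=> [x Hx|_ [x Hx <-] _ [y Iy <-]].
  exists (a * x); last by rewrite mulKf.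
  by move=> y Iy; rewrite mulrAC mulrC; apply: Hx; exists y.
by rewrite mulrACA mulVf // mul1r; apply: Hx.
Qed.

Lemma sub_v_op I : I `<=` v_op R I.
Proof. by move=> x Ix y Hy; rewrite mulrC; apply: Hy. Qed.

Lemma v_op_star : star_operation (v_op R).
Proof.
have Bi := ideal_base R.
split=> [I Ii|a I a0 Ii||I _|I J _ _ IJ|I _].
- by do 2![apply: colon_ideal => //].
- by rewrite /v_op colon_scale // colon_scale ?invr_eq0 // invrK.
- apply/seteqP; split; last exact: sub_v_op.
  move=> x vx; rewrite -[x]mulr1; apply: vx => y By; rewrite mul1r; exact: By.
- exact: sub_v_op.
- by do 2!apply: colon_subset.
- by apply/seteqP; split; [apply: colon_subset|]; apply: sub_v_op.
Qed.

(** If [y I] lies in [R], then so does [y] times the closure of [I], because [R] is closed. *)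
Lemma star_sub_v st I : star_operation st -> ideal I -> st I `<=` v_op R I.
Proof.
move=> sts Ii x Ix y Hy; rewrite mulrC -(star_base sts).
apply: (star_scaleW sts Ii (ideal_base R) _ Ix) => z Iz.
by rewrite (star_base sts); apply: Hy.
Qed.

Lemma v_starred_starred st I : star_operation st -> starred (v_op R) I -> starred st I.
Proof.
move=> sts [Ii IE]; split=> //; apply/seteqP; split; first exact: star_sub.
by rewrite {2}IE; apply: star_sub_v.
Qed.

Lemma v_noetherian st : star_operation st -> star_noetherian st ->
  star_noetherian (v_op R).
Proof.
move=> sts noeth I IP; apply: noeth => n; have [Iint Is] := IP n.
by split=> //; apply: v_starred_starred.
Qed.

End DivisorialClosure.

Section Dimension.
Variables (R : idomainType) (st : set {fraction R} -> set {fraction R}).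
Hypothesis R_not_field : ~ GRing.field_axiom R.
Local Notation K := {fraction R}.
Local Notation B := (base_ring R).

(** A nonzero nonunit [a] generates a proper closed ideal, and a maximal one above it is prime. A
    field has no such [a], and its dimension is 0. *)
Lemma star_prime_exists : star_operation st -> star_noetherian st ->
  exists M, star_prime st M.
Proof.
move=> sts noeth.
have [a [a0 aU]] : exists a : R, a != 0 /\ a \isn't a GRing.unit.
  apply: contrapT => na; apply: R_not_field => a a0; apply: contrapT => aU.
  by apply: na; exists a; split=> //; apply/negP.
have a0' : a%:F != 0 by rewrite tofrac_eq0.
have aBi : ideal (scale a%:F B) by apply: scale_ideal => //; apply: ideal_base.
have [|M Mmax _] := @star_max_above _ st (scale a%:F B) noeth.
  split=> [||aB].
  - split=> // _ [b Bb <-].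
    by have [_ _] := base_submod R; apply=> //; apply: base_tofrac.
  - split=> //; rewrite (star_scale sts) ?(star_base sts) //; exact: ideal_base.
  - have := base1 R; rewrite -aB => -[_ [b _ <-]] /eqP.
    rewrite -tofracM -(tofrac1 R) tofrac_eq => /eqP ab.
    by case/negP: aU; apply/unitrPr; exists b.
exists M; split; first exact: star_max_prime Mmax.
by case: Mmax => [[]].
Qed.

Lemma star_dim_eq1 : (exists M, star_prime st M) ->
  (forall P Q, star_prime st P -> star_prime st Q -> P `<=` Q -> P = Q) ->
  star_dim st = 1%E.
Proof.
move=> [M Ms] height1.
have c1 : star_chain st 1.
  exists (fun n => if n is 0%N then [set 0] else M); split=> // -[|//] _.
  split=> //; have [[[[[M0 _ _] [x Mx x0] _] _] _ _] _] := Ms.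
  by split=> [_ ->//|/(_ x Mx)/eqP]; rewrite (negPf x0).
have cle n : star_chain st n -> (n <= 1)%N.
  (* Position 0 of a chain is the zero ideal, so a length of at least 2 provides two comparable star
     primes. *)
  case: n => [|[|n]] // [P [_ PP]].
  have [P1 _] := PP 0%N isT; have [P2 [P12 nP21]] := PP 1%N isT.
  by case: nP21; rewrite (height1 _ _ P1 P2 P12).
(* The set of lengths contains 1, so the default value of [supremum] does not arise; the supremum is
   then identified by its uniqueness. *)
rewrite /star_dim /supremum ifF.
  apply: xget_subset1; last by move=> x y; apply: is_subset1_supremums.
  split=> [_ [n /cle n1 <-]|y]; first by rewrite lee_fin lez_nat.
  by apply; exists 1%N.
by apply/negP => /eqP E; have : set0 (1%:Z%:E) by rewrite -E; exists 1%N.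
Qed.

End Dimension.

Lemma star_dim_tilde_noetherian (R : idomainType)
    (st : set {fraction R} -> set {fraction R}) :
  ~ GRing.field_axiom R -> star_operation st -> star_noetherian (star_tilde st) ->
  (forall M, star_max st M -> star_stable_ideal st M) ->
  star_dim st = 1%E /\ star_dim (t_op R) = 1%E.
Proof.
move=> nf sts tnoeth stab.
have noeth := star_noetherian_of_tilde sts tnoeth.
have vs := @v_op_star R; have vnoeth := v_noetherian sts noeth.
have tE I : ideal I -> t_op R I = v_op R I by apply: star_f_noetherian.
have height1 P Q : star_prime st P -> star_prime st Q -> P `<=` Q -> P = Q.
  move=> [Pp _] [[Qint QB Qp] Qs] PQ.
  (* Both primes lie under one maximal [M]; since [P = M], [Q] is squeezed between them. *)
  have [|M Mmax QM] := @star_max_above _ st Q noeth; first by [].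
  have PM := stable_star_max_height1 sts tnoeth Mmax (stab M Mmax) Pp.
  apply/seteqP; split=> // x /QM; rewrite PM //.
  exact: subset_trans QM.
split; first exact: star_dim_eq1 (star_prime_exists nf sts noeth) height1.
(* A t-ideal is a v-ideal here, and every v-ideal is closed under [st]. *)
have tst P : star_prime (t_op R) P -> star_prime st P.
  move=> [Pp [Pi PE]]; split=> //; apply: v_starred_starred => //.
  by split; rewrite // -tE.
apply: star_dim_eq1 => [|P Q /tst Ps /tst Qs]; last exact: height1.
have [M [Mp [Mi ME]]] := star_prime_exists nf vs vnoeth.
by exists M; split=> //; split; rewrite // tE.
Qed.

Theorem corollary3p3 (R : idomainType) (R_not_field : ~ GRing.field_axiom R)
    (st : set {fraction R} -> set {fraction R})
    (st_star : star_operation st) :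
  [/\ star_noetherian (star_tilde st) ->
        (forall M, star_max st M -> star_stable_ideal st M) ->
        star_dim st = 1%E /\ star_dim (t_op R) = 1%E,
      noetherian R -> star_stable st ->
        star_dim st = 1%E /\ star_dim (t_op R) = 1%E &
      strong_mori R -> star_stable (t_op R) ->
        star_dim (t_op R) = 1%E].
Proof.
have vs := @v_op_star R.
split=> [|noeth stab|sm stab]; first exact: star_dim_tilde_noetherian.
  apply: star_dim_tilde_noetherian => // [I IP|M [[[Mi _] _ _] _]]; last exact: stab.
  by apply: noeth => n; case: (IP n).
(* Strong Mori is the chain condition for [star_tilde] of the v-operation, so the first claim is
   applied to [v_op R]. Stability transfers from t to v because the two agree on ideals. *)
suff vstab M : star_max (v_op R) M -> star_stable_ideal (v_op R) M.
  by have [] := star_dim_tilde_noetherian R_not_field vs sm vstab.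
move=> [[[Mi _] _ _] _].
have vnoeth := star_noetherian_of_tilde vs sm.
have tE I : ideal I -> t_op R I = v_op R I by apply: star_f_noetherian.
have := stab M Mi; rewrite /star_stable_ideal (tE M Mi).
have vMi := star_ideal vs Mi.
by rewrite tE //; apply: ideal_mul_ideal => //; do 2?[apply: colon_ideal => //].
Qed.
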